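(* The group $\operatorname{Aut}(P_3)$ is generated by the set $\{\rho,\sigma,\nu,\psi,\phi_{1,3},\phi_{2,3}\}$ of automorphisms of $P_3$ defined as follows, where $z=A_{1,2}A_{1,3}A_{2,3}$: $$\rho: A_{1,2}\mapsto A_{2,3}A_{1,2}A_{2,3}^{-1},\ A_{1,3}\mapsto A_{2,3},\ A_{2,3}\mapsto A_{1,3};$$ $$\sigma: A_{1,2}\mapsto A_{1,2}A_{1,3}^2,\ A_{1,3}\mapsto A_{1,3}^{-1},\ A_{2,3}\mapsto A_{2,3};$$ $$\nu: A_{1,2}\mapsto A_{2,3}^{-1}A_{1,2},\ A_{1,3}\mapsto A_{1,3}A_{2,3},\ A_{2,3}\mapsto A_{2,3};$$ $$\psi: A_{1,2}\mapsto A_{1,2}z^{-2},\ A_{1,3}\mapsto A_{1,3},\ A_{2,3}\mapsto A_{2,3};$$ $$\phi_{1,3}: A_{1,2}\mapsto A_{1,2}z,\ A_{1,3}\mapsto A_{1,3}z^{-1},\ A_{2,3}\mapsto A_{2,3};$$ $$\phi_{2,3}: A_{1,2}\mapsto A_{1,2}z,\ A_{1,3}\mapsto A_{1,3},\ A_{2,3}\mapsto A_{2,3}z^{-1}.$$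
   Context: $B_3=\langle\sigma_1,\sigma_2\mid\sigma_1\sigma_2\sigma_1=\sigma_2\sigma_1\sigma_2\rangle$, and $P_3$ is the kernel of $B_3\to S_3$, $\sigma_i\mapsto(i\ i+1)$. It is generated by $A_{1,2}=\sigma_1^2$, $A_{1,3}=\sigma_2\sigma_1^2\sigma_2^{-1}$, $A_{2,3}=\sigma_2^2$. One has $P_3=\langle z\rangle\times\langle A_{1,3},A_{2,3}\rangle$ with $z=A_{1,2}A_{1,3}A_{2,3}$ generating the infinite cyclic center $Z(P_3)$ and $\langle A_{1,3},A_{2,3}\rangle$ free of rank 2. The automorphisms $\rho,\sigma,\nu$ are the lifts, fixing $z$, of the automorphisms of $\langle A_{1,3},A_{2,3}\rangle$ given by the same formulas. *)

(* Defs.v *)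
From HB Require Import structures.
From mathcomp Require Import all_boot all_fingroup.
From mathcomp Require Import generic_quotient.
From mathcomp Require Import boolp classical_sets.

Set Implicit Arguments.
Unset Strict Implicit.
Unset Printing Implicit Defensive.

Local Open Scope group_scope.
Local Open Scope quotient_scope.

(* The letter (x, false) stands for x and (x, true) for its inverse. *)
Notation word X := (seq (X * bool)).

Section Presentation.
Variables (X : choiceType) (R : seq (word X * word X)).

(* The least congruence on words containing x x^-1 = x^-1 x = 1 and the pairs
   in R. *)
Inductive pres_cong : word X -> word X -> Prop :=
| pres_refl u : pres_cong u u
| pres_sym u v : pres_cong u v -> pres_cong v u
| pres_trans v u w : pres_cong u v -> pres_cong v w -> pres_cong u w
| pres_cat u u' v v' :
    pres_cong u u' -> pres_cong v v' -> pres_cong (u ++ v) (u' ++ v')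
| pres_cancel x b : pres_cong [:: (x, b); (x, ~~ b)] [::]
| pres_rel u v : (u, v) \in R -> pres_cong u v.

Definition pres_congb : rel (word X) := fun u v => `[< pres_cong u v >].

Lemma pres_congb_refl : reflexive pres_congb.
Proof. by move=> u; apply/asboolP; exact: pres_refl. Qed.

Lemma pres_congb_sym : symmetric pres_congb.
Proof. by move=> u v; apply/asboolP/asboolP; exact: pres_sym. Qed.

Lemma pres_congb_trans : transitive pres_congb.
Proof.
by move=> v u w /asboolP uv /asboolP vw; apply/asboolP; exact: pres_trans uv vw.
Qed.

Canonical pres_equiv :=
  EquivRel pres_congb pres_congb_refl pres_congb_sym pres_congb_trans.

Definition presented := {eq_quot pres_equiv}.
HB.instance Definition _ := Choice.on presented.

Definition pres_class (u : word X) : presented := \pi_({eq_quot pres_equiv}) u.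
Definition pres_repr (a : presented) : word X := repr (a : {eq_quot pres_equiv}).

Lemma pres_reprK a : pres_class (pres_repr a) = a.
Proof. exact: reprK. Qed.

Lemma pres_classP u v : pres_class u = pres_class v <-> pres_cong u v.
Proof.
split=> [/eqP|uv]; first by rewrite /pres_class eqmodE => /asboolP.
by apply/eqP; rewrite /pres_class eqmodE; apply/asboolP.
Qed.

Lemma pres_repr_class u : pres_cong (pres_repr (pres_class u)) u.
Proof. by apply/pres_classP; rewrite pres_reprK. Qed.

Definition word_inv (u : word X) : word X :=
  rev [seq (l.1, ~~ l.2) | l <- u].

Lemma word_inv_catl u : pres_cong (word_inv u ++ u) [::].
Proof.
elim: u => [|[x b] u IH]; first exact: pres_refl.
rewrite /word_inv /= rev_cons cat_rcons -[(x, ~~ b) :: _ :: u]cat1s.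
rewrite -[in _ :: u]cat1s.
apply: pres_trans IH; apply: pres_cat; first exact: pres_refl.
rewrite catA -[X in pres_cong _ X]cat0s; apply: pres_cat; last exact: pres_refl.
by rewrite -[in (x, b)](negbK b); exact: pres_cancel.
Qed.

Lemma word_invK : involutive word_inv.
Proof.
move=> u; rewrite /word_inv map_rev revK -map_comp map_id_in // => -[x b] _ /=.
by rewrite negbK.
Qed.

Lemma word_inv_cat u v : word_inv (u ++ v) = word_inv v ++ word_inv u.
Proof. by rewrite /word_inv map_cat rev_cat. Qed.

Lemma word_inv_cong u v : pres_cong u v -> pres_cong (word_inv u) (word_inv v).
Proof.
move=> uv; have catr w : pres_cong (w ++ word_inv w) [::].
  by rewrite -{1}(word_invK w); exact: word_inv_catl.
apply: (@pres_trans (word_inv u ++ (v ++ word_inv v))).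
  rewrite -{1}[word_inv u]cats0; apply: pres_cat; first exact: pres_refl.
  exact/pres_sym/catr.
rewrite catA -[X in pres_cong _ X]cat0s; apply: pres_cat; last exact: pres_refl.
apply: pres_trans (word_inv_catl u).
by apply: pres_cat; [exact: pres_refl | exact: pres_sym].
Qed.

Definition pres_mul (a b : presented) : presented :=
  pres_class (pres_repr a ++ pres_repr b).
Definition pres_one : presented := pres_class [::].
Definition pres_inv (a : presented) : presented :=
  pres_class (word_inv (pres_repr a)).

Lemma pres_mulE u v :
  pres_mul (pres_class u) (pres_class v) = pres_class (u ++ v).
Proof. by apply/pres_classP/pres_cat; exact: pres_repr_class. Qed.

Lemma pres_invE u : pres_inv (pres_class u) = pres_class (word_inv u).
Proof. by apply/pres_classP/word_inv_cong; exact: pres_repr_class. Qed.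

Lemma pres_mulA : associative pres_mul.
Proof.
move=> a b c; rewrite -(pres_reprK a) -(pres_reprK b) -(pres_reprK c).
by rewrite !pres_mulE catA.
Qed.

Lemma pres_mul1 : left_id pres_one pres_mul.
Proof. by move=> a; rewrite -(pres_reprK a) pres_mulE. Qed.

Lemma pres_mulr1 : right_id pres_one pres_mul.
Proof. by move=> a; rewrite -(pres_reprK a) pres_mulE cats0. Qed.

Lemma pres_mulV : left_inverse pres_one pres_inv pres_mul.
Proof.
move=> a; rewrite -(pres_reprK a) pres_invE pres_mulE.
by apply/pres_classP; exact: word_inv_catl.
Qed.

Lemma pres_mulVr : right_inverse pres_one pres_inv pres_mul.
Proof.
move=> a; rewrite -(pres_reprK a) pres_invE pres_mulE.
apply/pres_classP; rewrite -{1}[pres_repr a]word_invK; exact: word_inv_catl.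
Qed.

HB.instance Definition _ := isGroup.Build presented
  pres_mulA pres_mul1 pres_mulr1 pres_mulV pres_mulVr.

Definition pres_gen (x : X) : presented := pres_class [:: (x, false)].

Lemma pres_classM u v : pres_class (u ++ v) = pres_class u * pres_class v.
Proof. by rewrite -pres_mulE. Qed.

Variables (H : groupType) (f : X -> H).

Definition word_eval (u : word X) : H :=
  \prod_(l <- u) (if l.2 then (f l.1)^-1 else f l.1).

Definition pres_lift (a : presented) : H := word_eval (pres_repr a).

Lemma word_eval_cat u v : word_eval (u ++ v) = word_eval u * word_eval v.
Proof. by rewrite /word_eval big_cat. Qed.

Hypothesis fR : all (fun r => word_eval r.1 == word_eval r.2) R.

Lemma word_eval_cong u v : pres_cong u v -> word_eval u = word_eval v.
Proof.
elim=> // {u v} [u v w _ -> _ -> //|u u' v v' _ eu _ ev|x b|u v].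
- by rewrite !word_eval_cat eu ev.
- rewrite /word_eval !big_cons big_nil mulg1 /=.
  by case: b => /=; rewrite ?mulVg ?mulgV.
- by move=> /(allP fR) /eqP.
Qed.

Lemma pres_liftE u : pres_lift (pres_class u) = word_eval u.
Proof. exact/word_eval_cong/pres_repr_class. Qed.

Lemma pres_lift_gen x : pres_lift (pres_gen x) = f x.
Proof. by rewrite pres_liftE /word_eval big_seq1. Qed.

Lemma pres_liftM : {morph pres_lift : a b / a * b}.
Proof.
move=> a b; rewrite -(pres_reprK a) -(pres_reprK b) -pres_classM.
by rewrite !pres_liftE word_eval_cat.
Qed.

End Presentation.

Section Automorphisms.
Variable G : groupType.

Record Aut_of := AutOf {
  aut_fun :> G -> G;
  aut_morph : {morph aut_fun : x y / x * y};
  aut_bij : bijective aut_fun }.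

Lemma aut_ext (a b : Aut_of) : aut_fun a =1 aut_fun b -> a = b.
Proof.
case: a b => f fM fB [g gM gB] /= /funext efg; subst g.
by congr AutOf; exact: Prop_irrelevance.
Qed.

HB.instance Definition _ := gen_eqMixin Aut_of.
HB.instance Definition _ := gen_choiceMixin Aut_of.

Definition aut_one : Aut_of :=
  @AutOf id (fun x y => erefl) (Bijective (fun x => erefl) (fun x => erefl)).

Lemma aut_mul_morph (a b : Aut_of) : {morph (aut_fun a \o aut_fun b) : x y / x * y}.
Proof. by move=> x y; rewrite /= !aut_morph. Qed.

Definition aut_mul (a b : Aut_of) : Aut_of :=
  AutOf (aut_mul_morph a b) (bij_comp (aut_bij a) (aut_bij b)).

Lemma aut_inv_exists (a : Aut_of) : exists b : Aut_of, cancel (aut_fun a) b /\ cancel (aut_fun b) a.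
Proof.
case: (aut_bij a) => g ag ga.
have gM : {morph g : x y / x * y}.
  by move=> x y; apply: (can_inj ag); rewrite aut_morph !ga.
by exists (AutOf gM (Bijective ga ag)).
Qed.

Definition aut_inv (a : Aut_of) : Aut_of := sval (cid (aut_inv_exists a)).

Lemma aut_invK a : cancel (aut_fun a) (aut_inv a).
Proof. by rewrite /aut_inv; case: cid => ? []. Qed.

Lemma aut_invKV a : cancel (aut_fun (aut_inv a)) a.
Proof. by rewrite /aut_inv; case: cid => ? []. Qed.

Lemma aut_mulA : associative aut_mul. Proof. by move=> a b c; exact: aut_ext. Qed.
Lemma aut_mul1 : left_id aut_one aut_mul. Proof. by move=> a; exact: aut_ext. Qed.
Lemma aut_mulr1 : right_id aut_one aut_mul. Proof. by move=> a; exact: aut_ext. Qed.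
Lemma aut_mulV : left_inverse aut_one aut_inv aut_mul.
Proof. by move=> a; apply: aut_ext => x; exact: aut_invK. Qed.
Lemma aut_mulVr : right_inverse aut_one aut_inv aut_mul.
Proof. by move=> a; apply: aut_ext => x; exact: aut_invKV. Qed.

HB.instance Definition _ :=
  isGroup.Build Aut_of aut_mulA aut_mul1 aut_mulr1 aut_mulV aut_mulVr.

End Automorphisms.

Definition is_subgroup (G : groupType) (H : set G) : Prop :=
  [/\ H 1, forall x y, H x -> H y -> H (x * y) & forall x, H x -> H x^-1].

Definition subgroup_generated (G : groupType) (A : set G) : set G :=
  smallest (@is_subgroup G) A.

(* Indices are shifted: 0 and 1 in 'I_2 stand for sigma_1 and sigma_2, and S_3
   acts on {0, 1, 2}. *)
Definition braid_rels : seq (word 'I_2 * word 'I_2) :=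
  let s1 := (ord0, false) in let s2 := (ord_max, false) in
  [:: ([:: s1; s2; s1], [:: s2; s1; s2])].

Definition B3 := presented braid_rels.
HB.instance Definition _ := Group.on B3.

Definition sigma1 : B3 := pres_gen braid_rels ord0.
Definition sigma2 : B3 := pres_gen braid_rels ord_max.

Lemma braid_relation : sigma1 * sigma2 * sigma1 = sigma2 * sigma1 * sigma2.
Proof.
have gen3 i j k : pres_gen braid_rels i * pres_gen braid_rels j
    * pres_gen braid_rels k
    = pres_class braid_rels [:: (i, false); (j, false); (k, false)].
  rewrite -[LHS]/(pres_mul (pres_mul (pres_class _ _) (pres_class _ _))
    (pres_class _ _)).
  by rewrite !pres_mulE.
rewrite [LHS]gen3 [RHS]gen3.
by apply/pres_classP/pres_rel; rewrite inE.
Qed.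

Definition adj_transp (i : 'I_2) : 'S_3 :=
  tperm (widen_ord (leqnSn 2) i) (lift ord0 i).

Definition B3_to_S3 : B3 -> 'S_3 := pres_lift adj_transp.

Lemma adj_transp_braid :
  all (fun r => word_eval adj_transp r.1 == word_eval adj_transp r.2) braid_rels.
Proof.
rewrite /= andbT /word_eval !big_cons big_nil /= !mulg1; apply/eqP/permP => x.
rewrite !permM /adj_transp; apply/val_inj.
by case: x => [[|[|[|//]]] i]; do 3!rewrite [in LHS]permE /=;
   do 3!rewrite [in RHS]permE /=.
Qed.

Lemma B3_to_S3M : {morph B3_to_S3 : a b / a * b}.
Proof. exact: (pres_liftM adj_transp_braid). Qed.

Lemma B3_to_S3_1 : B3_to_S3 1 = 1.
Proof.
rewrite -[LHS]mul1g -[1 in LHS](mulVg (B3_to_S3 1)) -mulgA.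
by rewrite -B3_to_S3M mulg1 mulVg.
Qed.

Lemma B3_to_S3_gen (i : 'I_2) : B3_to_S3 (pres_gen braid_rels i) = adj_transp i.
Proof. exact: (pres_lift_gen adj_transp_braid). Qed.

Definition pure : pred B3 := [pred b | B3_to_S3 b == 1].

Lemma pure_group_closed : group_closed pure.
Proof.
split=> [|x y]; rewrite !inE; first by rewrite B3_to_S3_1.
move=> /eqP xK /eqP yK; rewrite B3_to_S3M xK mul1g.
by rewrite -[X in X == _]mul1g -{1}yK -B3_to_S3M mulgV B3_to_S3_1.
Qed.

Record P3 := PureBraid { pure_val :> B3; pure_valP : pure pure_val }.

HB.instance Definition _ := [isSub for pure_val].
HB.instance Definition _ := [Choice of P3 by <:].
HB.instance Definition _ :=
  SubChoice_isSubGroup.Build B3 pure P3 pure_group_closed.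

Lemma A12_pure : pure (sigma1 ^+ 2).
Proof. by rewrite /pure /= expgS expg1 B3_to_S3M B3_to_S3_gen tperm2. Qed.

Lemma A23_pure : pure (sigma2 ^+ 2).
Proof. by rewrite /pure /= expgS expg1 B3_to_S3M B3_to_S3_gen tperm2. Qed.

Lemma A13_pure : pure (sigma2 * sigma1 ^+ 2 * sigma2^-1).
Proof.
rewrite /pure /= 2!B3_to_S3M (eqP A12_pure) mulg1.
by rewrite -B3_to_S3M mulgV B3_to_S3_1.
Qed.

Definition A12 : P3 := PureBraid A12_pure.
Definition A13 : P3 := PureBraid A13_pure.
Definition A23 : P3 := PureBraid A23_pure.

Definition z : P3 := A12 * A13 * A23.

(* f is the automorphism of P_3 given by A_{1,2} |-> a12, A_{1,3} |-> a13,
   A_{2,3} |-> a23: it takes these values and is the only one that does. *)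
Definition defined_by (a12 a13 a23 : P3) (f : Aut_of P3) : Prop :=
  unique (fun g : Aut_of P3 => [/\ g A12 = a12, g A13 = a13 & g A23 = a23]) f.

(* Main.v *)
Require Import Defs.
From mathcomp Require Import all_boot all_fingroup.
From mathcomp Require Import boolp classical_sets.
From mathcomp Require Import zify.

(** Two facts carry the proof.

    First, P_3 is the direct product of the infinite cyclic group <z> and the
    free group on A13 and A23.  A Schreier transversal of P_3 in B_3 has six
    elements t, and writing t sigma_i = c t' with c in P_3 gives a cocycle c
    whose values are words in z, A13, A23.  Read in an arbitrary group with
    elements Z, A, B such that Z commutes with A and B, the same table still
    satisfies the braid relation, and so it defines a homomorphism from P_3
    sending z, A13, A23 to Z, A, B (lemma P3_lift).  Read in P_3 itself, it
    rewrites every element of P_3 as a product of z, A13, A23 and their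
    inverses (lemma P3_ind).  The existence and the uniqueness of the six
    automorphisms, the projection of P_3 to the free group, its kernel <z>
    and the infinite order of z all come from these two lemmas.

    Second, the automorphism group of the free group on two letters is
    generated by the swap, the inversion of a letter and a transvection
    (Nielsen; theorem nielsen).  An automorphism is composed on the right
    with elements of a subgroup K that contains these until the sum of the
    lengths of the images of the letters is minimal.  Since K contains the
    inner automorphisms, conjugation is among the available moves, and at a
    minimum the images then satisfy the Nielsen condition that no two
    neighbours can cancel a letter image completely.  Under this condition
    the length of an element does not exceed the length of its image, so the
    preimages of the letters are letters and the automorphism is a signed
    permutation, which lies in K.  Cancellation is measured by the length of
    common prefixes, an ultrametric quantity, so that the whole argument is
    arithmetic in the tree of reduced words.

    Now let f be an automorphism of P_3.  The centre of P_3 is <z>, because a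
    free group on two letters has trivial centre.  Hence f z is z or z^-1,
    and after composing with psi it is z.  Also f induces an automorphism of
    the free quotient, which by Nielsen is induced by a product of rho, sigma
    and nu.  Dividing by that product leaves an automorphism that multiplies
    A13 and A23 by powers of z and fixes z, and this is a product of powers
    of phi13 and phi23. *)

Set Implicit Arguments.
Unset Strict Implicit.
Unset Printing Implicit Defensive.

Local Open Scope group_scope.

(** * Homomorphisms and presented groups *)

Section Homomorphisms.
Variables (G H : groupType) (f : G -> H) (fM : {morph f : x y / x * y}).

Lemma hom1 : f 1 = 1.
Proof. by apply: (@mulgI _ (f 1)); rewrite -fM !mulg1. Qed.

Lemma homV : {morph f : x / x^-1}.
Proof. by move=> x; apply: (@mulgI _ (f x)); rewrite -fM !mulgV hom1. Qed.

Lemma homX n : {morph f : x / x ^+ n}.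
Proof. by move=> x; elim: n => [|n IH]; rewrite ?hom1 // !expgS fM IH. Qed.

End Homomorphisms.

Section Presented.
Variables (X : choiceType) (R : seq (word X * word X)).

Lemma pres_classV u : pres_class R (word_inv u) = (pres_class R u)^-1.
Proof. by rewrite -pres_invE. Qed.

Lemma pres_ind (P : presented R -> Prop) :
    P 1 -> (forall x, P (pres_gen R x)) ->
    (forall g h, P g -> P h -> P (g * h)) -> (forall g, P g -> P g^-1) ->
  forall g, P g.
Proof.
move=> P1 Pgen PM PV g; rewrite -(pres_reprK g).
elim: (pres_repr g) => [//|[x b] u IH]; rewrite -cat1s pres_classM.
apply: PM => //; case: b; last exact: Pgen.
by rewrite -[_ :: _]/(word_inv [:: (x, false)]) pres_classV; exact/PV/Pgen.
Qed.

Lemma pres_hom_ext (H : groupType) (f f' : presented R -> H) :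
    {morph f : g h / g * h} -> {morph f' : g h / g * h} ->
  (forall x, f (pres_gen R x) = f' (pres_gen R x)) -> f =1 f'.
Proof.
move=> fM f'M ff'; apply: pres_ind => // [|g h e e'|g e].
- by rewrite !hom1.
- by rewrite fM f'M e e'.
- by rewrite !homV // e.
Qed.

End Presented.

(** * Words and reduced words *)

Notation free X := (presented ([::] : seq (word X * word X))).

Section ReducedWords.
Variable X : choiceType.
Implicit Types (l m : X * bool) (u v w : word X).

Notation cls := (pres_class ([::] : seq (word X * word X))).
Implicit Types g h k : free X.

Definition flip l : X * bool := (l.1, ~~ l.2).

Lemma flipK : involutive flip.
Proof. by case=> x b; rewrite /flip /= negbK. Qed.

Lemma flip_neq l : flip l != l.
Proof. by case: l => x b; rewrite xpair_eqE eqxx /=; case: b. Qed.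

Definition reduced : pred (word X) := sorted (fun l m => m != flip l).

Lemma reduced_take n w : reduced w -> reduced (take n w).
Proof.
rewrite -{1}[w](cat_take_drop n); case: (take n w) => //= l u.
by rewrite cat_path => /andP[].
Qed.

(** Left multiplication by a letter, on reduced words. *)
Definition push l w : word X :=
  if w is m :: w' then if m == flip l then w' else l :: w else [:: l].

Definition normalize : word X -> word X := foldr push [::].

Lemma push_reduced l w : reduced w -> reduced (push l w).
Proof.
case: w => [//|m w] /= rw; case: ifP => [_|ml]; first exact: path_sorted rw.
by rewrite /= ml.
Qed.

Lemma push_flip l w : reduced w -> push l (push (flip l) w) = w.
Proof.
case: w => [|m w] /= rw; first by rewrite eqxx.
rewrite flipK; case: eqP => [e|_]; last by rewrite /= eqxx.
by case: w rw => [|k w] /=; rewrite e // => /andP[/negPf->].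
Qed.

Lemma normalize_reduced u : reduced (normalize u).
Proof. by elim: u => //= l u; apply: push_reduced. Qed.

Lemma normalize_id w : reduced w -> normalize w = w.
Proof.
elim: w => //= l w IH rw; rewrite IH; last exact: path_sorted rw.
by case: w rw {IH} => //= m w /andP[/negPf->].
Qed.

Lemma foldr_push_reduced u w : reduced w -> reduced (foldr push w u).
Proof. by move=> rw; elim: u => //= l u; apply: push_reduced. Qed.

(** The letters act on reduced words by bijections that are inverse to each
    other for inverse letters, so congruent words act alike. *)
Lemma foldr_push_cong u v : pres_cong [::] u v ->
  forall w, reduced w -> foldr push w u = foldr push w v.
Proof.
elim=> {u v} [//|u v _ IH w rw|u v w _ IH1 _ IH2 t rt|u u' v v' _ IH1 _ IH2 w rw
  |x b w rw|//].
- by rewrite IH.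
- by rewrite IH1 ?IH2.
- by rewrite !foldr_cat IH2 // IH1 // foldr_push_reduced.
- exact: (push_flip (x, b) rw).
Qed.

Definition nf g : word X := normalize (pres_repr g).

Lemma nf_class u : nf (cls u) = normalize u.
Proof. by apply: foldr_push_cong => //; exact: pres_repr_class. Qed.

Lemma nf_reduced g : reduced (nf g).
Proof. exact: normalize_reduced. Qed.

Lemma class_cancel u l v : cls (u ++ flip l :: l :: v) = cls (u ++ v).
Proof.
rewrite -[_ :: _ :: v]/([:: flip l; l] ++ v) !pres_classM.
have -> : cls [:: flip l; l] = 1; last by rewrite mul1g.
by rewrite -{2}[l]flipK; case: l => x b; apply/pres_classP; exact: pres_cancel.
Qed.

Lemma class_normalize u : cls (normalize u) = cls u.
Proof.
elim: u => //= l u IH; rewrite -(cat1s l u) pres_classM -{}IH -pres_classM.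
case: (normalize u) => [|m w] //=; case: eqP => // ->.
by rewrite -{1}[l]flipK (class_cancel [::]).
Qed.

Lemma nfK : cancel nf cls.
Proof. by move=> g; rewrite class_normalize pres_reprK. Qed.

Lemma nf_class_reduced w : reduced w -> nf (cls w) = w.
Proof. by move=> rw; rewrite nf_class normalize_id. Qed.

Lemma word_inv_reduced w : reduced w -> reduced (word_inv w).
Proof.
rewrite /reduced /word_inv rev_sorted sorted_map.
by apply: sub_sorted => l m /=; rewrite -/(flip l) -/(flip m) flipK eq_sym.
Qed.

Lemma nfV g : nf g^-1 = word_inv (nf g).
Proof.
by rewrite -{1}(nfK g) -pres_classV nf_class_reduced ?word_inv_reduced ?nf_reduced.
Qed.

Lemma word_inv_cons l w : word_inv (l :: w) = rcons (word_inv w) (flip l).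
Proof. by rewrite /word_inv /= rev_cons. Qed.

Lemma size_word_inv w : size (word_inv w) = size w.
Proof. by rewrite size_rev size_map. Qed.

(** * The length function and common prefixes *)

Fixpoint lcp u v : nat :=
  match u, v with
  | l :: u', m :: v' => if l == m then (lcp u' v').+1 else 0
  | _, _ => 0
  end.

Lemma lcpC u v : lcp u v = lcp v u.
Proof. by elim: u v => [|l u IH] [|m v] //=; rewrite eq_sym IH. Qed.

(** The common prefix of [u] and [v] and that of [v] and [w] are both prefixes
    of [v], so the shorter of them is a prefix of [u] and of [w]. *)
Lemma lcp_ultra u v w : minn (lcp u v) (lcp v w) <= lcp u w.
Proof.
elim: u v w => [|l u IH] [|m v] [|n w] //=; rewrite ?min0n ?minn0 //.
case: (eqVneq l m) => [->|_]; last by rewrite min0n.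
by case: eqP; rewrite ?minn0 // minnSS ltnS.
Qed.

Lemma lcp_size u v : lcp u v <= size u.
Proof.
by elim: u v => [|l u IH] [|m v] //=; case: eqP => // _; rewrite ltnS.
Qed.

Lemma lcp_take n u : lcp (take n u) u = size (take n u).
Proof. by elim: u n => [|l u IH] [|n] //=; rewrite eqxx IH. Qed.

Lemma lcp_nth l0 u v i : i < lcp u v -> nth l0 u i = nth l0 v i.
Proof.
elim: u v i => [|l u IH] [|m v] [|i] //=; case: eqP => //= _.
by rewrite ltnS; exact: IH.
Qed.

Definition len g := size (nf g).
(** The Gromov product of [g] and [h], based at 1, in the Cayley tree. *)
Definition gromov g h := lcp (nf g) (nf h).

Lemma len1 : len 1 = 0.
Proof. by rewrite /len -[1]/(cls [::]) nf_class. Qed.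

Lemma len0 g : len g = 0 -> g = 1.
Proof. by rewrite -{2}(nfK g) /len; case: (nf g). Qed.

Lemma lenV g : len g^-1 = len g.
Proof. by rewrite /len nfV size_word_inv. Qed.

Lemma len_letter l : len (cls [:: l]) = 1%N.
Proof. by rewrite /len nf_class. Qed.

Lemma len_le1 g : len g <= 1 -> g = 1 \/ exists l, g = cls [:: l].
Proof.
rewrite /len -{2 3}(nfK g); case: (nf g) => [|l [|//]] _; first by left.
by right; exists l.
Qed.

Lemma gromovC g h : gromov g h = gromov h g.
Proof. exact: lcpC. Qed.

Lemma gromov_ultra h g k : minn (gromov g h) (gromov h k) <= gromov g k.
Proof. exact: lcp_ultra. Qed.

Lemma reduced_cat u v : reduced u -> reduced v -> lcp u v = 0 ->
  reduced (word_inv u ++ v).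
Proof.
case: u => [//|l u]; case: v => [|m v] ru rv; first by rewrite cats0 word_inv_reduced.
rewrite /=; case: eqP => // /eqP lm _.
rewrite word_inv_cons cat_rcons /reduced sorted_cat_cons -word_inv_cons.
by apply/andP; split; [exact: word_inv_reduced | rewrite /= flipK eq_sym lm].
Qed.

(** Cancelling the common prefix is all the reduction that [u^-1 v] needs. *)
Lemma size_normalize_cat u v : reduced u -> reduced v ->
  size (normalize (word_inv u ++ v)) + (lcp u v).*2 = size u + size v.
Proof.
elim: u v => [|l u IH] v ru rv; first by rewrite /= normalize_id ?addn0.
case: v rv => [|m v] rv.
  by rewrite cats0 normalize_id ?word_inv_reduced // size_word_inv.
case: (eqVneq l m) => [lm|lm].
  have /= := IH v (path_sorted ru) (path_sorted rv).
  rewrite lm eqxx -!nf_class.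
  by rewrite word_inv_cons cat_rcons class_cancel; lia.
rewrite normalize_id ?reduced_cat //= ?(negPf lm) //.
by rewrite size_cat size_word_inv addn0.
Qed.

Lemma len_gromov g h : len (g^-1 * h) + (gromov g h).*2 = len g + len h.
Proof.
rewrite -size_normalize_cat ?nf_reduced //; congr (size _ + _).
by rewrite -nf_class pres_classM pres_classV !nfK.
Qed.

(** Equivalently [g] is shorter than [g ^+ 2], as the free group acts on its
    Cayley tree without fixed points or inverted edges.  If half of [w] cancelled
    against itself, the letters of [w] in mirror positions would be inverse to
    each other; this is absurd for the middle letter when the length is odd, and
    for the two middle letters of a reduced word when it is even. *)
Lemma gromov_self g : g != 1 -> (gromov g^-1 g).*2 < len g.
Proof.
rewrite /gromov /len nfV => g1; have := nf_reduced g; set w := nf g => rw.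
have w0 : 0 < size w by rewrite lt0n; apply: contra g1 => /eqP/len0->.
rewrite ltnNge; apply/negP => le_w; have [l0 _] : exists l, l \in w.
  by case: (w) w0 => // l ? _; exists l; rewrite mem_head.
have mirror i : i < lcp (word_inv w) w -> flip (nth l0 w ((size w).-1 - i)) = nth l0 w i.
  move=> ik; rewrite -(lcp_nth l0 ik) /word_inv nth_rev size_map; last first.
    by have := lcp_size w (word_inv w); rewrite lcpC; lia.
  rewrite (nth_map l0) ?subnS; last by lia.
  congr (flip (nth _ _ _)); lia.
case: (boolP (odd (size w))) => ow.
  have := mirror (size w)./2; rewrite (_ : _ - _ = (size w)./2); last by lia.
  by move/(_ ltac:(lia))/eqP; rewrite (negPf (flip_neq _)).
have := mirror (size w)./2.-1; rewrite (_ : _ - _ = (size w)./2.-1.+1); last by lia.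
move=> /(_ ltac:(lia)) e.
have /sortedP := rw => /(_ l0 (size w)./2.-1); rewrite -e flipK eqxx.
by move/(_ ltac:(lia)).
Qed.

(** The element reached after [n] steps on the way from 1 to [g]. *)
Lemma prefix_exists n g : n <= len g -> exists2 r, len r = n & gromov r g = n.
Proof.
move=> ng; have rt : reduced (take n (nf g)) by exact/reduced_take/nf_reduced.
exists (cls (take n (nf g))); rewrite /len /gromov nf_class_reduced //.
  by rewrite size_takel.
by rewrite lcp_take size_takel.
Qed.

Lemma lenM g h : len (g * h) + (gromov g^-1 h).*2 = len g + len h.
Proof. by have := len_gromov g^-1 h; rewrite invgK lenV. Qed.

(** If half of [h] cancels against [g] in [g * h] and the other half in [h * g],
    then [h = p * r^-1] and [g = r * m * p^-1] without cancellation, with [p] and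
    [r] of equal length.  So [g * h = r * m * r^-1] becomes [m] after conjugation
    by [r], while [h] becomes [r^-1 * p], which is no longer than [h].  Without
    the conjugation nothing is gained, [g * h] and [h * g] being as long as [g]. *)
Lemma conj_shortens g h : 0 < len h -> len h <= len g ->
    (gromov h g^-1).*2 = len h -> (gromov h^-1 g).*2 = len h ->
  exists r, len (r^-1 * (g * h) * r) + len (r^-1 * h * r) < len g + len h.
Proof.
move=> h_gt0 le_hg hg hVg.
have [r len_r r_h] : exists2 r, len r = gromov h g^-1 & gromov r h^-1 = gromov h g^-1.
  by apply: prefix_exists; rewrite lenV; lia.
pose p := h * r; have len_p : len p = gromov h g^-1.
  by have := len_gromov r h^-1; rewrite -invMg -/p !lenV; lia.
have p_h : gromov p h = gromov h g^-1.
  by have := len_gromov p h; rewrite /p invMg mulgVK lenV -/p; lia.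
have len_gp : len (g * p) = len g - gromov h g^-1.
  have := lenM g p; have := gromov_ultra h p g^-1; have := lcp_size (nf p) (nf g^-1).
  by rewrite (gromovC g^-1) -/(gromov _ _) -/(len _) p_h minnn; lia.
have g_gp : gromov g (g * p) = len g - gromov h g^-1.
  by have := len_gromov g (g * p); rewrite mulKg; lia.
have r_gp : gromov h g^-1 <= gromov r (g * p).
  by have := gromov_ultra g r (g * p); have := gromov_ultra h^-1 r g; lia.
exists r; have -> : r^-1 * (g * h) * r = r^-1 * (g * p) by rewrite !mulgA.
have -> : r^-1 * h * r = r^-1 * p by rewrite mulgA.
by have := len_gromov r (g * p); have := len_gromov r p; lia.
Qed.

Definition letter l : free X := cls [:: l].

Lemma letter_flip l : letter (flip l) = (letter l)^-1.
Proof. by rewrite -pres_classV. Qed.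

End ReducedWords.

(** * Nielsen reduced families *)

Section NielsenReduced.
Variables (X Y : choiceType) (f : free X -> free Y).
Hypothesis fM : {morph f : g h / g * h}.
Notation e l := (f (letter l)).
Hypothesis f_reduced : forall x y w : X * bool, y != flip x -> w != flip y ->
  gromov (e x)^-1 (e y) + gromov (e y)^-1 (e w) < len (e y).

(** A word in the images keeps at its left end the part of its first letter image
    that survives cancellation, so that the next letter put on the left cancels
    against the word no more than against that image alone.  The second
    inequality is the induction invariant: besides one unit for each letter it
    keeps in reserve the amount that a letter on the left may still cancel. *)
Lemma nielsen_reduced_word x w y : reduced (x :: w) -> x != flip y ->
  let E := f (pres_class [::] (x :: w)) in
  gromov (e y)^-1 E = gromov (e y)^-1 (e x) /\
  (size w).+1 + gromov (e y)^-1 (e x) <= len E.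
Proof.
elim: w x y => [|t w IH] x y /= rw xy.
  have xx : x != flip x by rewrite eq_sym flip_neq.
  by split=> //; have := f_reduced xy xx; rewrite add1n; apply/leq_ltn_trans/leq_addr.
have [tx rw'] := andP rw; have [g_eq le_len] := IH t x rw' tx.
have -> : f (pres_class [::] [:: x, t & w]) = e x * f (pres_class [::] (t :: w)).
  by rewrite -fM -pres_classM.
set E' := f (pres_class _ _) in g_eq le_len *.
have N := f_reduced xy tx.
have h1 := lenM (e x) E'; have h2 := len_gromov (e x) (e x * E').
rewrite mulKg in h2; rewrite g_eq in h1.
(* By f_reduced, [e x * E'] shares more with [e x] than [(e y)^-1] does; the two
   ultrametric inequalities then make its products with both equal. *)
have u1 := gromov_ultra (e x) (e y)^-1 (e x * E').
have u2 := gromov_ultra (e x * E') (e y)^-1 (e x).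
rewrite (gromovC _ (e x)) in u2.
by split; lia.
Qed.

Lemma nielsen_reduced_len g : len g <= len (f g).
Proof.
rewrite {1}/len -{2}(nfK g); have := nf_reduced g; case: (nf g) => // x w rw.
have xx : x != flip x by rewrite eq_sym flip_neq.
have [_] := nielsen_reduced_word rw xx; exact/leq_trans/leq_addr.
Qed.

End NielsenReduced.

(** * Automorphisms of the free group on two letters *)

Section NielsenTheorem.
Notation F := (free bool).
Notation a := (letter (false, false)).
Notation b := (letter (true, false)).
Variables (K : Aut_of F -> Prop) (r s n : Aut_of F).
Hypothesis K_subgroup : is_subgroup K.
Hypotheses (Kr : K r) (Ks : K s) (Kn : K n).
Hypotheses (ra : r a = b) (rb : r b = a).
Hypotheses (sa : s a = a^-1) (sb : s b = b).
Hypotheses (na : n a = a * b) (nb : n b = b).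

Let K1 : K 1. Proof. by case: K_subgroup. Qed.
Let KM x y : K x -> K y -> K (x * y). Proof. by case: K_subgroup => _ + _; apply. Qed.
Let KV x : K x -> K x^-1. Proof. by case: K_subgroup => _ _; apply. Qed.

Lemma autME (G : groupType) (f g : Aut_of G) x : (f * g) x = f (g x).
Proof. by []. Qed.

Lemma autV (G : groupType) (f : Aut_of G) x : f x^-1 = (f x)^-1.
Proof. exact: (homV (@aut_morph _ f)). Qed.

Lemma aut_free_ext (f g : Aut_of F) : f a = g a -> f b = g b -> f = g.
Proof.
move=> fga fgb; apply: aut_ext; apply: pres_hom_ext; try exact: aut_morph.
by case.
Qed.

(** The eight substitutions of letters for letters are generated by the swap and
    one inversion. *)
Lemma signed_permutation x y : x.1 != y.1 ->
  exists2 k, K k & k a = letter x /\ k b = letter y.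
Proof.
have sgn c : exists2 k, K k & k a = letter (false, c) /\ k b = b.
  case: c; last by exists 1.
  by exists s => //; rewrite sa sb -letter_flip.
case: x y => i c [j d] /= ij.
have [kc Kc [ca cb]] := sgn c; have [kd Kd [da db]] := sgn d.
have Kcd : K (r * kd * r * kc) by do !apply: KM.
have Er l : r (letter l) = letter (~~ l.1, l.2).
  have r0 j' : r (letter (j', false)) = letter (~~ j', false) by case: j'.
  case: l => l [] //=.
  by rewrite -[(l, true)]/(flip (l, false)) letter_flip autV r0 -letter_flip.
have Ea : (r * kd * r * kc) a = letter (false, c).
  have kd_b : kd (letter (true, c)) = letter (true, c).
    by case: (c); rewrite // -[(true, true)]/(flip (true, false)) letter_flip autV db.
  by rewrite !autME ca Er kd_b Er.
have Eb : (r * kd * r * kc) b = letter (true, d).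
  by rewrite !autME cb rb da Er.
case: i ij; case: j => //= _; last by exists (r * kd * r * kc).
by exists (r * (r * kd * r * kc)); [exact: KM | rewrite !(autME r) Ea Eb !Er].
Qed.

(** The transvection [a |-> a b] and its conjugate [a |-> b^-1 a] under the
    inversion of [a] compose to the conjugation [a |-> b^-1 a b].  This gives
    conjugation by [b], the swap gives conjugation by [a], and these generate. *)
Lemma inner_mem g : exists2 k, K k & forall h, k h = g * h * g^-1.
Proof.
have inner (k : Aut_of F) g' : k a = g' * a * g'^-1 -> k b = g' * b * g'^-1 ->
    forall h, k h = g' * h * g'^-1.
  move=> ka kb; apply: (pres_hom_ext (f' := fun h => g' * h * g'^-1)).
  - exact: aut_morph.
  - by move=> h h'; rewrite !mulgA mulgVK.
  - by case.
have VQ g' : (exists2 k, K k & forall h, k h = g' * h * g'^-1) ->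
    exists2 k, K k & forall h, k h = g'^-1 * h * g'^-1^-1.
  move=> [k Kk kE]; exists k^-1; first exact: KV.
  move=> h; apply: (bij_inj (aut_bij k)).
  by rewrite -autME mulgV kE invgK !mulgA mulgV mul1g mulgK.
have b_inner : exists2 k, K k & forall h, k h = b * h * b^-1.
  rewrite -[b]invgK; apply: VQ; exists (n * (s * n * s)); first by do !apply: KM.
  have sns : s (n (s a)) = b^-1 * a.
    by rewrite sa [n _]autV na [LHS]autV aut_morph sa sb invMg invgK.
  apply: inner; rewrite !autME.
    by rewrite sns aut_morph [n _^-1]autV na nb invgK mulgA.
  by rewrite sb nb sb nb mulVg mul1g invgK.
move: g; apply: pres_ind => [|[]|g h [k Kk kE] [k' Kk' kE']|//] //.
- by exists 1 => // h; rewrite invg1 mulg1 mul1g.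
- have [k Kk kE] := b_inner.
  exists (r * k * r); first by do !apply: KM.
  by apply: inner; rewrite !autME ?ra ?rb kE !aut_morph autV ?ra ?rb.
- exists (k * k'); first exact: KM.
  by move=> t; rewrite autME kE' kE invMg !mulgA.
Qed.

Definition total_len (f : Aut_of F) := len (f a) + len (f b).

(** Automorphisms for which no element of [K], composed on the right, decreases
    the total length. *)
Section Minimal.
Variable f : Aut_of F.
Hypothesis f_min : forall k, K k -> total_len f <= total_len (f * k).
Notation e l := (f (letter l)).

Lemma eV l : e (flip l) = (e l)^-1.
Proof. by rewrite letter_flip autV. Qed.

Lemma len_e x : len (e x) = len (e (x.1, false)).
Proof.
case: x => x [] //=.
by rewrite -[(x, true)]/(flip (x, false)) eV lenV.
Qed.

Lemma e_neq1 x : e x != 1.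
Proof.
apply/eqP; rewrite -(hom1 (@aut_morph _ f)) => /(bij_inj (aut_bij f)).
by move/(congr1 (@len _)); rewrite len_letter len1.
Qed.

Lemma len_e_gt0 x : 0 < len (e x).
Proof. by rewrite lt0n; apply: contra (e_neq1 x) => /eqP/len0->. Qed.

Lemma total_lenE x y : x.1 != y.1 -> total_len f = len (e x) + len (e y).
Proof. by rewrite (len_e x) (len_e y) /total_len; case: x.1; case: y.1 => //= _; lia. Qed.

Lemma transvection x y : x.1 != y.1 ->
  exists2 k, K k & k a = letter x * letter y /\ k b = letter y.
Proof.
move=> /signed_permutation[k Kk [ka kb]]; exists (k * n); first exact: KM.
by rewrite !autME na nb aut_morph ka kb.
Qed.

(** Otherwise the Nielsen move [x |-> x * y] would shorten the pair. *)
Lemma minimal_le x y : x.1 != y.1 -> len (e x) <= len (e x * e y).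
Proof.
move=> xy; have [k Kk [ka kb]] := transvection xy.
have := f_min Kk; rewrite (total_lenE xy) /total_len !autME ka kb aut_morph.
lia.
Qed.

Lemma minimal_gromov x y : x.1 != y.1 ->
  ((gromov (e x)^-1 (e y)).*2 <= len (e y)) * ((gromov (e x)^-1 (e y)).*2 <= len (e x)).
Proof.
move=> xy; have le1 := minimal_le xy.
have h : len (e x * e y) + (gromov (e x)^-1 (e y)).*2 = len (e x) + len (e y).
  exact: lenM.
have le2 : len (e y) <= len (e x * e y).
  rewrite -(lenV (e y)) -(lenV (e x * e y)) invMg -!eV; apply: minimal_le.
  by rewrite eq_sym.
by split; lia.
Qed.

(** For different generators this is minimality; otherwise [t] is [y], and
    gromov_self applies. *)
Lemma minimal_half y t : t != flip y ->
  (gromov (e y)^-1 (e t)).*2 < len (e y) \/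
  t.1 != y.1 /\ (gromov (e y)^-1 (e t)).*2 <= len (e y).
Proof.
move=> ty; case: (eqVneq t.1 y.1) => ty1; last first.
  by right; split=> //; rewrite (minimal_gromov _).2 // eq_sym.
left; rewrite (_ : t = y); first exact: gromov_self (e_neq1 y).
by case: (t) (y) ty1 ty => i c [j d] /= ->; rewrite xpair_eqE eqxx; case: c; case: d.
Qed.

(** The condition can only fail when exactly half of [e y] cancels on each side,
    and then both neighbours [x], [w] lie over the other generator.  If they are
    mutually inverse, [e y] would cancel half of itself, against gromov_self; if
    they are equal, conj_shortens contradicts minimality. *)
Lemma minimal_reduced x y w : y != flip x -> w != flip y ->
  gromov (e x)^-1 (e y) + gromov (e y)^-1 (e w) < len (e y).
Proof.
have y_gt0 := len_e_gt0 y.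
have self_y : (gromov (e y)^-1 (e y)).*2 < len (e y) by exact: gromov_self (e_neq1 y).
move=> yx wy; rewrite ltnNge; apply/negP; rewrite gromovC => le_y.
have xy : flip x != flip (flip y) by rewrite flipK eq_sym.
have := minimal_half xy; have := minimal_half wy.
rewrite !eV invgK lenV => -[?|[w1 w2]] [?|/= [x1 x2]]; try lia.
have [wx|wx] : w = flip x \/ w = x.
  case: (w) (x) (y) w1 x1 => i c [j d] [[] ?] /=; case: i; case: j => // _ _;
    case: c; case: d; by [left | right].
  rewrite wx eV in le_y w2.
  have : minn (gromov (e y)^-1 (e x)^-1) (gromov (e y) (e x)^-1)
           <= gromov (e y)^-1 (e y).
    by rewrite [gromov (e y) _]gromovC; exact: gromov_ultra.
  by lia.
rewrite {}wx in w1 w2 le_y wy.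
have [x_le y_le] := minimal_gromov w1.
have [q lt_q] : exists q, len (q^-1 * (e x * e y) * q) + len (q^-1 * e y * q)
                    < len (e x) + len (e y).
  rewrite [gromov _ (e y)]gromovC in y_le.
  have le_yx : len (e y) <= len (e x) by lia.
  have eq1 : (gromov (e y) (e x)^-1).*2 = len (e y) by lia.
  have eq2 : (gromov (e y)^-1 (e x)).*2 = len (e y) by lia.
  exact: conj_shortens.
have [k Kk [ka kb]] := transvection w1.
(* Conjugation by [q^-1] after [f] is [f] after conjugation by [q']. *)
have [q' fq] : exists q', f q' = q^-1 by exists (f^-1 q^-1); rewrite -autME mulgV.
have [k' Kk' k'E] := inner_mem q'.
have := f_min (KM Kk' Kk); rewrite (total_lenE w1) /total_len !autME ka kb !k'E.
rewrite !aut_morph autV fq invgK leqNgt.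
by rewrite lt_q.
Qed.

End Minimal.

(** Nielsen's theorem in rank two: at a minimum of the total length lengths do
    not decrease, so the inverse sends the two letters to letters. *)
Theorem nielsen f : K f.
Proof.
have [m] := ubnP (total_len f); elim: m f => // m IH f le_m.
have [[k [Kk lt_k]]|nomin] := pselect (exists k, K k /\ total_len (f * k) < total_len f).
  by rewrite -(mulgK k f); apply: KM (KV Kk); apply/IH/(leq_trans lt_k).
have f_min k : K k -> total_len f <= total_len (f * k).
  by move=> Kk; rewrite leqNgt; apply/negP => lt_k; apply: nomin; exists k.
have le_len := nielsen_reduced_len (@aut_morph _ f) (minimal_reduced f_min).
have pre l : exists2 x, f^-1 (letter l) = letter x & f (letter x) = letter l.
  have fx : f (f^-1 (letter l)) = letter l by rewrite -autME mulgV.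
  have := le_len (f^-1 (letter l)); rewrite fx len_letter => /len_le1[g1|[x gx]].
    by move: (len_letter l); rewrite -/(letter l) -fx g1 (hom1 (@aut_morph _ f)) len1.
  by exists x => //; rewrite -fx gx.
have [x xa fx] := pre (false, false); have [y yb fy] := pre (true, false).
(* Equal or inverse letters would have equal or inverse images. *)
have xy : x.1 != y.1.
  apply/eqP => exy; have : y = x \/ y = flip x.
    case: (x) (y) exy => i c [j d] /= ->; case: c; case: d; by [left | right].
  case=> yx; move: fy; rewrite yx ?letter_flip ?autV fx -?letter_flip.
    by move/(congr1 (@nf _)); rewrite !nf_class.
  by move/(congr1 (@nf _)); rewrite !nf_class.
have [k Kk [ka kb]] := signed_permutation xy.
rewrite -[f]invgK; apply: KV; rewrite (_ : f^-1 = k) //.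
by apply: aut_free_ext; rewrite ?xa ?yb.
Qed.

End NielsenTheorem.

(** * The Schreier cocycle of P_3 in B_3 *)

(** The right cosets of P_3, named after their representatives 1, sigma_1,
    sigma_2, sigma_1 sigma_2, sigma_2 sigma_1, sigma_1 sigma_2 sigma_1. *)
Inductive coset := Cos1 | Cos_s1 | Cos_s2 | Cos_s12 | Cos_s21 | Cos_s121.

Definition coset_step (i : 'I_2) (c : coset) : coset :=
  if i == ord0 then
    match c with
    | Cos1 => Cos_s1 | Cos_s1 => Cos1
    | Cos_s2 => Cos_s21 | Cos_s21 => Cos_s2
    | Cos_s12 => Cos_s121 | Cos_s121 => Cos_s12
    end
  else
    match c with
    | Cos1 => Cos_s2 | Cos_s2 => Cos1
    | Cos_s1 => Cos_s12 | Cos_s12 => Cos_s1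
    | Cos_s21 => Cos_s121 | Cos_s121 => Cos_s21
    end.

Lemma coset_stepK i : involutive (coset_step i).
Proof. by rewrite /coset_step; case: eqP => _; case. Qed.

Lemma ord2P (i : 'I_2) : i = ord0 \/ i = ord_max.
Proof.
case: i => [[|[|//]] i2]; [left | right]; exact: val_inj.
Qed.

Definition coset_steps (w : word 'I_2) c := foldl (fun c l => coset_step l.1 c) c w.

Section Cocycle.
Variables (H : groupType) (Z A B : H).

(** The element [c] of [t sigma_i = c t'], for [t] and [t'] coset representatives,
    written in [Z], [A], [B] standing for z, A13, A23; so A12 is
    [Z * B^-1 * A^-1]. *)
Definition gen_cocycle (i : 'I_2) (c : coset) : H :=
  if i == ord0 then
    match c with
    | Cos_s1 => Z * B^-1 * A^-1 | Cos_s21 => A | Cos_s121 => B | _ => 1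
    end
  else
    match c with
    | Cos_s2 => B | Cos_s12 => B^-1 * A * B | Cos_s121 => Z * B^-1 * A^-1 | _ => 1
    end.

Definition letter_cocycle (l : 'I_2 * bool) c : H :=
  if l.2 then (gen_cocycle l.1 (coset_step l.1 c))^-1 else gen_cocycle l.1 c.

Fixpoint cocycle (w : word 'I_2) c : H :=
  if w is l :: w' then letter_cocycle l c * cocycle w' (coset_step l.1 c) else 1.

Lemma cocycle_cat u v c :
  cocycle (u ++ v) c = cocycle u c * cocycle v (coset_steps u c).
Proof. by elim: u c => [|l u IH] c /=; rewrite ?mul1g // IH mulgA. Qed.

Lemma cocycle_mem (K : H -> Prop) : is_subgroup K -> K Z -> K A -> K B ->
  forall w c, K (cocycle w c).
Proof.
case=> K1 KM KV KZ KA KB; have Kgen i c : K (gen_cocycle i c).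
  rewrite /gen_cocycle; case: ifP; case: c => _ //;
    by do ?apply: (KM); do ?apply: (KV).
elim=> //= l w IH c; apply: KM => //.
by rewrite /letter_cocycle; case: l.2 => //; apply: KV.
Qed.

Hypotheses (ZA : commute Z A) (ZB : commute Z B).

(** The commutation of [Z] with [A] and [B] enters through the braid relation:
    its two sides give different words in [Z], [A], [B] at three of the six cosets. *)
Lemma cocycle_cong u v : pres_cong braid_rels u v ->
  forall c, coset_steps u c = coset_steps v c /\ cocycle u c = cocycle v c.
Proof.
elim=> {u v} [//|u v _ IH c|u v w _ IH1 _ IH2 c|u u' v v' _ IH1 _ IH2 c|i e c|u v].
- by have [-> ->] := IH c.
- by have [-> ->] := IH1 c.
- rewrite !cocycle_cat /coset_steps !foldl_cat -!/(coset_steps _ _).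
  have [-> ->] := IH1 c; have [-> ->] := IH2 (coset_steps u' c); by split.
- rewrite /= coset_stepK /letter_cocycle /= mulg1.
  by case: e => /=; rewrite ?coset_stepK ?mulgV ?mulVg.
rewrite inE => /eqP[-> ->] c.
have pull T U : commute Z T -> T * (Z * U) = Z * (T * U).
  by move=> ZT; rewrite mulgA -ZT -mulgA.
have ZBAB : commute Z (B^-1 * A * B).
  by do ?apply: commuteM => //; apply: commuteV.
case: c; rewrite /= /letter_cocycle /gen_cocycle /coset_step /= ?(mulg1, mul1g) //;
  split=> //.
- by rewrite mulgVK -(mulgA Z _ A^-1) pull // !mulgA mulgK mulgK.
- by rewrite -!mulgA mulVKg.
- by rewrite -(mulgA Z _ A^-1) pull // pull // -!mulgA !mulVKg mulKg mulgV mulVg.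
Qed.

End Cocycle.

Lemma pure_valM (p q : P3) : pure_val (p * q) = pure_val p * pure_val q.
Proof. by []. Qed.

Lemma pure_valV (p : P3) : pure_val p^-1 = (pure_val p)^-1.
Proof. by []. Qed.

(** * Generators and universal property of P_3 *)

Definition coset_repr (c : coset) : B3 :=
  match c with
  | Cos1 => 1 | Cos_s1 => sigma1 | Cos_s2 => sigma2
  | Cos_s12 => sigma1 * sigma2 | Cos_s21 => sigma2 * sigma1
  | Cos_s121 => sigma1 * sigma2 * sigma1
  end.

(** The representatives other than 1 have a nontrivial permutation: each of them
    moves 0, or moves 2. *)
Lemma coset_repr_pure c : pure (coset_repr c) -> c = Cos1.
Proof.
have moves (g : B3) (i : 'I_3) : pure g -> B3_to_S3 g i = i by move=> /eqP->; rewrite perm1.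
have [s1 s2] : B3_to_S3 sigma1 = adj_transp ord0 /\ B3_to_S3 sigma2 = adj_transp ord_max.
  by split; exact: B3_to_S3_gen.
have t0 (x : 'I_3) : adj_transp ord0 x = nth x [:: inord 1; inord 0] x :> 'I_3.
  apply: val_inj; rewrite permE /=.
  by case: x => [[|[|[|//]]] i]; rewrite /= ?inordK.
have t1 (x : 'I_3) : adj_transp ord_max x = nth x [:: x; inord 2; inord 1] x :> 'I_3.
  apply: val_inj; rewrite permE /=.
  by case: x => [[|[|[|//]]] i]; rewrite /= ?inordK.
case: c => // /moves m;
  [have := m ord0 | have := m ord_max | have := m ord0 | have := m ord0 | have := m ord0];
  rewrite /coset_repr ?B3_to_S3M ?s1 ?s2 ?permM ?t0 ?t1 => /(congr1 val) /=;
  by rewrite ?inordK ?t0 ?t1 ?inordK.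
Qed.

Lemma A12E : A12 = z * A23^-1 * A13^-1.
Proof. by rewrite /z !mulgK. Qed.

Definition garside : B3 := sigma1 * sigma2 * sigma1.

Lemma garside_sigma1 : garside * sigma1 = sigma2 * garside.
Proof. by rewrite {1}/garside braid_relation /garside !mulgA. Qed.

Lemma garside_sigma2 : garside * sigma2 = sigma1 * garside.
Proof. by rewrite {2}/garside braid_relation /garside !mulgA. Qed.

(** The full twist.  Its centrality follows, as the half twist exchanges the two
    generators by conjugation. *)
Lemma z_val : pure_val z = garside * garside.
Proof.
have -> : pure_val z = sigma1 * garside * (sigma1 * sigma2).
  by rewrite /z !pure_valM /= !expg2 /garside !mulgA mulgVK.
rewrite -garside_sigma2 -mulgA; congr (_ * _).
by rewrite mulgA -braid_relation.
Qed.

Lemma B3_ind (P : B3 -> Prop) : P 1 -> P sigma1 -> P sigma2 ->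
  (forall g h, P g -> P h -> P (g * h)) -> (forall g, P g -> P g^-1) -> forall g, P g.
Proof.
by move=> P1 Ps1 Ps2; apply: pres_ind => // i; case: (ord2P i) => ->.
Qed.

Lemma z_central p : commute z p.
Proof.
apply: val_inj; suff: forall x, commute (pure_val z) x by apply.
apply: B3_ind => [|||g h|g].
- exact: commute1.
- by rewrite /commute z_val -mulgA garside_sigma1 mulgA garside_sigma2 -mulgA.
- by rewrite /commute z_val -mulgA garside_sigma2 mulgA garside_sigma1 -mulgA.
- exact: commuteM.
- exact: commuteV.
Qed.

Lemma coset_repr_gen (i : 'I_2) c : coset_repr c * pres_gen braid_rels i
  = pure_val (gen_cocycle z A13 A23 i c) * coset_repr (coset_step i c).
Proof.
have A12val : pure_val (z * A23^-1 * A13^-1) = sigma1 ^+ 2 by rewrite -A12E.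
case: (ord2P i) => ->; rewrite -?/sigma1 -?/sigma2; case: c;
  rewrite /gen_cocycle /coset_step /= ?mul1g ?mulg1 // ?A12val ?expg2 //.
- by rewrite !mulgA mulgVK.
- by rewrite -/garside garside_sigma1 /garside braid_relation !mulgA.
- apply: (@mulgI _ sigma2); rewrite !mulgA -braid_relation.
  rewrite invMg !mulgA mulgV mul1g mulVg mul1g mulgVK.
  by rewrite -/garside garside_sigma2 /garside !mulgA.
- by rewrite braid_relation.
- by rewrite !mulgK -/garside garside_sigma2 /garside !mulgA.
Qed.

Lemma coset_repr_word w c : coset_repr c * pres_class braid_rels w
  = pure_val (cocycle z A13 A23 w c) * coset_repr (coset_steps w c).
Proof.
elim: w c => [|[i b] w IH] c /=; first by rewrite mulg1 mul1g.
rewrite -cat1s pres_classM mulgA -[RHS]mulgA -IH mulgA; congr (_ * _).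
case: b; last exact: coset_repr_gen.
rewrite /letter_cocycle /= -[pres_class _ _]/(pres_class _ (word_inv [:: (i, false)])).
rewrite pres_classV; apply: (@mulIg _ (pres_gen braid_rels i)).
by rewrite mulgVK -mulgA coset_repr_gen coset_stepK mulKg.
Qed.

Lemma pure_coset_steps p : coset_steps (pres_repr (pure_val p)) Cos1 = Cos1.
Proof.
apply: coset_repr_pure; set w := pres_repr _.
have := coset_repr_word w Cos1; rewrite mul1g pres_reprK => e.
have -> : coset_repr (coset_steps w Cos1) =
  pure_val ((cocycle z A13 A23 w Cos1)^-1 * p) by rewrite pure_valM e pure_valV mulKg.
exact: pure_valP.
Qed.

(** The Schreier rewriting of [p], evaluated in P_3, gives [p] back. *)
Lemma pure_cocycle p : cocycle z A13 A23 (pres_repr (pure_val p)) Cos1 = p.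
Proof.
apply: val_inj; have := coset_repr_word (pres_repr (pure_val p)) Cos1.
by rewrite pure_coset_steps /= mul1g mulg1 pres_reprK.
Qed.

Lemma P3_ind (K : P3 -> Prop) : is_subgroup K -> K z -> K A13 -> K A23 ->
  forall p, K p.
Proof. by move=> Ks Kz Ka Kb p; rewrite -(pure_cocycle p); exact: cocycle_mem. Qed.

(** The universal property of the presentation of P_3 with generators z, A13,
    A23 and the relations that z commutes with A13 and A23. *)
Lemma P3_lift (H : groupType) (Z A B : H) : commute Z A -> commute Z B ->
  exists h : P3 -> H, {morph h : p q / p * q} /\ [/\ h z = Z, h A13 = A & h A23 = B].
Proof.
move=> ZA ZB; pose h p := cocycle Z A B (pres_repr (pure_val p)) Cos1.
have hE w p : pure_val p = pres_class braid_rels w -> h p = cocycle Z A B w Cos1.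
  move=> e; apply: (cocycle_cong ZA ZB _ _).2.
  by rewrite e; exact: pres_repr_class.
have hM : {morph h : p q / p * q}.
  move=> p q; rewrite (hE (pres_repr (pure_val p) ++ pres_repr (pure_val q))).
    by rewrite cocycle_cat pure_coset_steps.
  by rewrite pres_classM !pres_reprK.
have hA12 : h A12 = Z * B^-1 * A^-1.
  rewrite (hE [:: (ord0, false); (ord0, false)]) /= ?mul1g ?mulg1 //.
  by rewrite expg2 -pres_classM.
have hA13 : h A13 = A.
  rewrite (hE [:: (ord_max, false); (ord0, false); (ord0, false); (ord_max, true)]) /=.
    by rewrite /letter_cocycle /gen_cocycle /coset_step /= !mul1g invg1 !mulg1.
  rewrite -[X in pres_class _ X]/(([:: (ord_max, false)] ++
    ([:: (ord0, false)] ++ [:: (ord0, false)])) ++ word_inv [:: (ord_max, false)]).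
  by rewrite !pres_classM pres_classV expg2.
have hA23 : h A23 = B.
  rewrite (hE [:: (ord_max, false); (ord_max, false)]) /= ?mul1g ?mulg1 //.
  by rewrite expg2 -pres_classM.
exists h; split=> //; split=> //; rewrite /z !hM hA12 hA13 hA23.
by rewrite !mulgVK.
Qed.

Lemma P3_hom_ext (H : groupType) (f g : P3 -> H) :
    {morph f : p q / p * q} -> {morph g : p q / p * q} ->
  f z = g z -> f A13 = g A13 -> f A23 = g A23 -> f =1 g.
Proof.
move=> fM gM ez e13 e23; apply: P3_ind => //; split=> [|x y ex ey|x ex].
- by rewrite (hom1 fM) (hom1 gM).
- by rewrite fM gM ex ey.
- by rewrite (homV fM) (homV gM) ex.
Qed.

Lemma P3_aut_ext (f g : Aut_of P3) :
  f z = g z -> f A13 = g A13 -> f A23 = g A23 -> f = g.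
Proof. by move=> *; apply/aut_ext/P3_hom_ext => //; exact: aut_morph. Qed.

(** An automorphism is given by images of z, A13, A23 and by elements [Z'], [A'],
    [B'] that the inverse assigns to them; the last two hypotheses verify on
    generators that the two substitutions are mutually inverse. *)
Lemma P3_aut (Z A B Z' A' B' : P3) :
    commute Z A -> commute Z B -> commute Z' A' -> commute Z' B' ->
    (forall h : P3 -> P3, {morph h : p q / p * q} -> h z = Z -> h A13 = A -> h A23 = B ->
       [/\ h Z' = z, h A' = A13 & h B' = A23]) ->
    (forall h : P3 -> P3, {morph h : p q / p * q} -> h z = Z' -> h A13 = A' -> h A23 = B' ->
       [/\ h Z = z, h A = A13 & h B = A23]) ->
  exists f : Aut_of P3, [/\ f z = Z, f A13 = A & f A23 = B].
Proof.
move=> /P3_lift/[apply]-[h [hM [hz ha hb]]] /P3_lift/[apply]-[k [kM [kz ka kb]]].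
move=> /(_ h hM hz ha hb)[hz' ha' hb'] /(_ k kM kz ka kb)[kz' ka' kb'].
have hk : cancel h k.
  by apply: (P3_hom_ext (f := k \o h) (g := id)) => [p q|//|||] /=;
    [rewrite hM kM | rewrite hz | rewrite ha | rewrite hb].
have kh : cancel k h.
  by apply: (P3_hom_ext (f := h \o k) (g := id)) => [p q|//|||] /=;
    [rewrite kM hM | rewrite kz | rewrite ka | rewrite kb].
by exists (AutOf hM (Bijective hk kh)).
Qed.

(** As [A12 = z * A23^-1 * A13^-1], the images of z, A13, A23 determine that of A12. *)
Lemma defined_byI (a12 a13 a23 : P3) (f : Aut_of P3) :
  f z = a12 * a13 * a23 -> f A13 = a13 -> f A23 = a23 -> defined_by a12 a13 a23 f.
Proof.
move=> fz f13 f23; split=> [|g [g12 g13 g23]].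
  by split=> //; rewrite A12E 2!aut_morph !autV fz f13 f23 !mulgK.
by apply: P3_aut_ext; rewrite ?fz /z ?aut_morph ?g12 ?g13 ?g23.
Qed.

Lemma P3_aut_rho : exists f : Aut_of P3, [/\ f z = z, f A13 = A23 & f A23 = A13].
Proof. by apply: (@P3_aut _ _ _ z A23 A13); try exact: z_central. Qed.

Lemma P3_aut_sigma : exists f : Aut_of P3, [/\ f z = z, f A13 = A13^-1 & f A23 = A23].
Proof.
apply: (@P3_aut _ _ _ z A13^-1 A23); try exact: z_central;
  by move=> h hM hz h13 h23; rewrite (homV hM) hz h13 h23 invgK.
Qed.

Lemma P3_aut_nu : exists f : Aut_of P3, [/\ f z = z, f A13 = A13 * A23 & f A23 = A23].
Proof.
apply: (@P3_aut _ _ _ z (A13 * A23^-1) A23); try exact: z_central;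
  by move=> h hM hz h13 h23; rewrite hM ?(homV hM) hz h13 h23 ?mulgK ?mulgVK.
Qed.

Lemma P3_aut_psi : exists f : Aut_of P3, [/\ f z = z^-1, f A13 = A13 & f A23 = A23].
Proof.
apply: (@P3_aut _ _ _ z^-1 A13 A23); try exact/commute_sym/commuteV/commute_sym/z_central;
  by move=> h hM hz h13 h23; rewrite (homV hM) hz h13 h23 invgK.
Qed.

Lemma P3_aut_phi13 :
  exists f : Aut_of P3, [/\ f z = z, f A13 = A13 * z^-1 & f A23 = A23].
Proof.
apply: (@P3_aut _ _ _ z (A13 * z) A23); try exact: z_central;
  by move=> h hM hz h13 h23; rewrite hM ?(homV hM) hz h13 h23 ?mulgK ?mulgVK.
Qed.

Lemma P3_aut_phi23 :
  exists f : Aut_of P3, [/\ f z = z, f A13 = A13 & f A23 = A23 * z^-1].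
Proof.
apply: (@P3_aut _ _ _ z A13 (A23 * z)); try exact: z_central;
  by move=> h hM hz h13 h23; rewrite hM ?(homV hM) hz h13 h23 ?mulgK ?mulgVK.
Qed.

(** * P_3 as the product of its centre and a free group *)

Section DirectProduct.
Notation F := (free bool).
Notation a := (letter (false, false)).
Notation b := (letter (true, false)).

(** Let [x] be the generator other than that of the first letter of [g].  Then
    [x * g] is longer than [g] and has no prefix in common with [g], whereas
    [g * x] begins with [g] as soon as it is longer than [g]. *)
Lemma free_center (g : F) : (forall h, commute g h) -> g = 1.
Proof.
move=> gC; apply: contrapT => /eqP g1.
have len_g : 0 < len g by rewrite lt0n; apply: contra g1 => /eqP/len0->.
have [x [xg0 x_g]] : exists x,
    gromov g (letter x * g) = 0 /\ len (letter x * g) = (len g).+1.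
  case e: (nf g) len_g => [|l w]; rewrite /len e // => _; exists (~~ l.1, false).
  have r : reduced [:: (~~ l.1, false), l & w].
    have := nf_reduced g; rewrite e /= => ->; rewrite andbT.
    by case: (l) => [[] []].
  have -> : nf (letter (~~ l.1, false) * g) = [:: (~~ l.1, false), l & w].
    by rewrite -[g]nfK e -pres_classM nf_class_reduced.
  rewrite /gromov e -{1}[g]nfK e -pres_classM /= nf_class_reduced //=.
  by case: (l) => [[] []].
have := len_gromov g (g * letter x); rewrite mulKg gC xg0 x_g len_letter; lia.
Qed.

Definition is_power (G : groupType) (c x : G) := exists n, x = c ^+ n \/ x = c ^- n.

Lemma is_power_subgroup (G : groupType) (c : G) : is_subgroup (is_power c).
Proof.
have mixed m n : is_power c (c ^+ m * c ^- n).
  case: (leqP n m) => [|/ltnW] mn.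
    by exists (m - n); left; rewrite expgnFr.
  by exists (n - m); right; rewrite expgnFr // invgF.
split.
- by exists 0; left.
- move=> x y [m [->|->]] [n [->|->]] //.
  + by exists (m + n); left; rewrite expgnDr.
  + have -> : c ^- m * c ^+ n = c ^+ n * c ^- m; last exact: mixed.
    by apply: commute_sym; apply: commuteV; apply: commuteX2.
  + by exists (n + m); right; rewrite expgnDr invMg.
- by move=> x [m [->|->]]; exists m; [right | left; rewrite invgK].
Qed.

Lemma free_proj_exists : exists free_proj : P3 -> F, {morph free_proj : p q / p * q} /\
  [/\ free_proj z = 1, free_proj A13 = a & free_proj A23 = b].
Proof. by apply: P3_lift; apply: commute_sym; exact: commute1. Qed.

Definition free_proj : P3 -> F := sval (cid free_proj_exists).

Lemma free_projM : {morph free_proj : p q / p * q}.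
Proof. by rewrite /free_proj; case: cid => ? []. Qed.

Lemma free_proj_z : free_proj z = 1.
Proof. by rewrite /free_proj; case: cid => ? [? []]. Qed.

Lemma free_proj_A13 : free_proj A13 = a.
Proof. by rewrite /free_proj; case: cid => ? [? []]. Qed.

Lemma free_proj_A23 : free_proj A23 = b.
Proof. by rewrite /free_proj; case: cid => ? [? []]. Qed.

Definition free_emb : F -> P3 := pres_lift (fun i : bool => if i then A23 else A13).

Lemma free_embM : {morph free_emb : g h / g * h}.
Proof. exact: pres_liftM. Qed.

Lemma free_emb_gen i : free_emb (letter (i, false)) = if i then A23 else A13.
Proof. by apply: (@pres_lift_gen _ [::] _ (fun i : bool => if i then A23 else A13)). Qed.

Lemma free_embK : cancel free_emb free_proj.
Proof.
apply: (pres_hom_ext (f := free_proj \o free_emb) (f' := id)) => // [g h|[]] /=.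
- by rewrite free_embM free_projM.
- by rewrite -/(letter _) free_emb_gen free_proj_A23.
- by rewrite -/(letter _) free_emb_gen free_proj_A13.
Qed.

Lemma free_proj_power c : is_power z c -> free_proj c = 1.
Proof.
by case=> n [->|->];
  rewrite ?(homV free_projM) (homX free_projM) free_proj_z expg1n ?invg1.
Qed.

Lemma power_central c p : is_power z c -> commute c p.
Proof.
case=> n [->|->]; apply: commute_sym; [|apply: commuteV];
  by apply: commuteX; apply: commute_sym; exact: z_central.
Qed.

(** The elements of this form are a subgroup because the powers of z are central. *)
Lemma free_proj_fiber p : exists2 c, is_power z c & p = c * free_emb (free_proj p).
Proof.
have [Z1 ZM ZV] := is_power_subgroup z.
apply: (P3_ind (K := fun p => exists2 c, is_power z c & p = c * free_emb (free_proj p))).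
- split.
  + by exists 1 => //; rewrite (hom1 free_projM) (hom1 free_embM) mulg1.
  + move=> x y [c Zc xE] [d Zd yE]; exists (c * d); first exact: ZM.
    rewrite free_projM free_embM {1}xE {1}yE -!mulgA; congr (_ * _).
    by rewrite !mulgA; congr (_ * _); rewrite (power_central _ Zd).
  + move=> x [c Zc xE]; exists c^-1; first exact: ZV.
    rewrite (homV free_projM) (homV free_embM) {1}xE invMg.
    by rewrite (power_central _ (ZV _ Zc)).
- by exists z; [exists 1%N; left | rewrite free_proj_z (hom1 free_embM) mulg1].
- by exists 1 => //; rewrite free_proj_A13 mul1g free_emb_gen.
- by exists 1 => //; rewrite free_proj_A23 mul1g free_emb_gen.
Qed.

Lemma free_proj_ker p : free_proj p = 1 -> is_power z p.
Proof.
have [c Zc ->] := free_proj_fiber p.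
rewrite free_projM free_embK free_proj_power // mul1g => ->.
by rewrite (hom1 free_embM) mulg1.
Qed.

Lemma central_power p : (forall q, commute p q) -> is_power z p.
Proof.
move=> pC; apply/free_proj_ker/free_center => g.
by rewrite /commute -(free_embK g) -!free_projM pC.
Qed.

Lemma letter_exp_len (X : choiceType) (l : X * bool) n : len (letter l ^+ n) = n.
Proof.
have -> : letter l ^+ n = pres_class [::] (nseq n l).
  by elim: n => [//|n IH]; rewrite expgS IH -pres_classM.
rewrite /len nf_class_reduced ?size_nseq //.
case: n => //= n; elim: n => //= n ->; by rewrite eq_sym flip_neq.
Qed.

(** P_3 maps to a free group with z going to a letter. *)
Lemma z_expI m n : z ^+ m = z ^+ n -> m = n.
Proof.
have [chi [chiM [chi_z _ _]]] : exists chi : P3 -> F, {morph chi : p q / p * q} /\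
    [/\ chi z = a, chi A13 = 1 & chi A23 = 1] by apply: P3_lift; exact: commute1.
by move=> /(congr1 (fun p => len (chi p))) /=; rewrite !(homX chiM) chi_z !letter_exp_len.
Qed.

Lemma aut_is_power (f : Aut_of P3) c : is_power z c -> is_power z (f c).
Proof.
move=> [n cE]; apply: central_power => q.
have [q' <-] : exists q', f q' = q by exists (f^-1 q); rewrite -autME mulgV.
rewrite /commute -!aut_morph; congr (f _).
by rewrite power_central //; exists n.
Qed.

(** An automorphism and its inverse send z to powers of z with exponents [n] and
    [m] up to sign; their product is 1 because z has infinite order. *)
Lemma aut_z (f : Aut_of P3) : f z = z \/ f z = z^-1.
Proof.
have Zz : is_power z z by exists 1%N; left.
have [n fz] := aut_is_power f Zz; have [m gz] := aut_is_power f^-1 Zz.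
have fX k : f (z ^+ k) = f z ^+ k by exact: (homX (@aut_morph _ f)).
have zE : z = z ^+ (n * m) \/ z = z ^- (n * m).
  have : f (f^-1 z) = z by rewrite -autME mulgV.
  case: gz => ->; rewrite ?autV fX; case: fz => ->;
    rewrite ?expVgn ?invgK -expgnA => e; rewrite e; by [left | right].
have nm : (n * m = 1)%N.
  case: zE => [|/eqP]; first by rewrite -{1}[z]expg1 => /z_expI.
  by rewrite -mulg_eq1 -expgS -(expg0 z) => /eqP/z_expI.
have n1 : n = 1%N by move: nm => /eqP; rewrite muln_eq1 => /andP[/eqP].
by case: fz => ->; rewrite n1 expg1; [left | right].
Qed.

(** The kernel of the projection is the centre of P_3, which automorphisms
    preserve. *)
Lemma induced_aut (f : Aut_of P3) :
  exists g : Aut_of F, forall p, free_proj (f p) = g (free_proj p).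
Proof.
have fact (h : Aut_of P3) p : free_proj (h p) = free_proj (h (free_emb (free_proj p))).
  have [c Zc pE] := free_proj_fiber p.
  by rewrite {1}pE aut_morph free_projM free_proj_power ?mul1g //; exact: aut_is_power.
pose ind (h : Aut_of P3) g := free_proj (h (free_emb g)).
have indM (h : Aut_of P3) : {morph ind h : x y / x * y}.
  by move=> x y; rewrite /ind free_embM aut_morph free_projM.
have indK (h k : Aut_of P3) : k * h = 1 -> cancel (ind h) (ind k).
  by move=> kh g; rewrite /ind -fact -autME kh free_embK.
have ind_bij := Bijective (indK f f^-1 (mulVg f)) (indK f^-1 f (mulgV f)).
by exists (AutOf (indM f) ind_bij) => p; rewrite fact.
Qed.

(** * Generation of the automorphism group of P_3 *)

Section Generation.
Variables (K : set (Aut_of P3)) (rho sigma nu psi phi13 phi23 : Aut_of P3).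
Hypothesis K_subgroup : is_subgroup K.
Hypotheses (Krho : K rho) (Ksigma : K sigma) (Knu : K nu).
Hypotheses (Kpsi : K psi) (Kphi13 : K phi13) (Kphi23 : K phi23).
Hypothesis rhoE : [/\ rho z = z, rho A13 = A23 & rho A23 = A13].
Hypothesis sigmaE : [/\ sigma z = z, sigma A13 = A13^-1 & sigma A23 = A23].
Hypothesis nuE : [/\ nu z = z, nu A13 = A13 * A23 & nu A23 = A23].
Hypothesis psiE : [/\ psi z = z^-1, psi A13 = A13 & psi A23 = A23].
Hypothesis phi13E : [/\ phi13 z = z, phi13 A13 = A13 * z^-1 & phi13 A23 = A23].
Hypothesis phi23E : [/\ phi23 z = z, phi23 A13 = A13 & phi23 A23 = A23 * z^-1].

Let K1 : K 1. Proof. by case: K_subgroup. Qed.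
Let KM x y : K x -> K y -> K (x * y). Proof. by case: K_subgroup => _ + _; apply. Qed.
Let KV x : K x -> K x^-1. Proof. by case: K_subgroup => _ _; apply. Qed.

Lemma aut_inv_eq (G : groupType) (f : Aut_of G) x y : f x = y -> f^-1 y = x.
Proof. by move=> <-; rewrite -autME mulVg. Qed.

(** The automorphisms of the free quotient that are induced by elements of [K]
    fixing z form a subgroup, to which Nielsen's theorem applies. *)
Lemma lift_free_aut (g : Aut_of F) :
  exists2 k, K k & k z = z /\ forall p, free_proj (k p) = g (free_proj p).
Proof.
have [r rE] := induced_aut rho; have [s sE] := induced_aut sigma.
have [n nE] := induced_aut nu.
case: rhoE sigmaE nuE => [rz ra rb] [sz sa sb] [nz na nb].
apply: (@nielsen (fun g => exists2 k, K k &
  k z = z /\ forall p, free_proj (k p) = g (free_proj p)) r s n).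
- split.
  + by exists 1.
  + move=> x y [k Kk [kz kE]] [k' Kk' [k'z k'E]]; exists (k * k'); first exact: KM.
    by split=> [|p]; rewrite !autME ?k'z // kE k'E.
  + move=> x [k Kk [kz kE]]; exists k^-1; first exact: KV.
    split=> [|p]; first exact: aut_inv_eq.
    by apply/esym/aut_inv_eq; rewrite -kE -autME mulgV.
- by exists rho.
- by exists sigma.
- by exists nu.
- by rewrite -free_proj_A13 -rE ra free_proj_A23.
- by rewrite -free_proj_A23 -rE rb free_proj_A13.
- by rewrite -free_proj_A13 -sE sa (homV free_projM).
- by rewrite -free_proj_A23 -sE sb.
- by rewrite -free_proj_A13 -nE na free_projM free_proj_A23.
- by rewrite -free_proj_A23 -nE nb.
Qed.

(** These are the automorphisms that fix z and induce the identity on the free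
    quotient; powers of phi13 and phi23 account for all of them. *)
Lemma central_mul c d : is_power z c -> is_power z d ->
  exists2 k, K k & [/\ k z = z, k A13 = c * A13 & k A23 = d * A23].
Proof.
have Kexp (phi : Aut_of P3) A B : K phi -> phi z = z -> phi A = A * z^-1 -> phi B = B ->
    forall c, is_power z c -> exists2 k, K k & [/\ k z = z, k A = c * A & k B = B].
  move=> Kphi fz fA fB e [m eE].
  have [k Kk [kz kA kB]] : exists2 k, K k & [/\ k z = z, k A = z ^- m * A & k B = B].
    elim: m {eE} => [|m [k Kk [kz kA kB]]].
      by exists 1 => //; rewrite expg0 invg1 mul1g.
    exists (phi * k); first exact: KM.
    rewrite !autME kz kA kB fz fB; split=> //.
    rewrite aut_morph autV (homX (@aut_morph _ phi)) fz fA.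
    rewrite expgS [(z * _)^-1]invMg -[RHS]mulgA; congr (_ * _).
    by apply: commuteV; apply: commute_sym; exact: z_central.
  case: eE => ->; last by exists k.
  exists k^-1; first exact: KV.
  split; apply: aut_inv_eq => //.
  by rewrite aut_morph kA (homX (@aut_morph _ k)) kz mulVKg.
case: phi13E phi23E => [z13 a13 b13] [z23 a23 b23] Zc Zd.
have [k Kk [kz ka kb]] := Kexp _ _ _ Kphi13 z13 a13 b13 _ Zc.
have [k' Kk' [k'z k'b k'a]] := Kexp _ _ _ Kphi23 z23 b23 a23 _ Zd.
exists (k * k'); first exact: KM.
rewrite !autME k'z k'a k'b kz ka aut_morph kb; split=> //; congr (_ * _).
by case: Zd => n [->|->]; rewrite ?autV (homX (@aut_morph _ k)) kz.
Qed.

(** Undo first the action on the centre, then the action on the free quotient;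
    what remains is covered by central_mul. *)
Lemma generation f : K f.
Proof.
have fix_z (g : Aut_of P3) : g z = z -> K g.
  move=> gz; have [g' g'E] := induced_aut g.
  have [k Kk [kz kE]] := lift_free_aut g'.
  have proj_id p : free_proj ((k^-1 * g) p) = free_proj p.
    by apply: (bij_inj (aut_bij g')); rewrite -kE -autME mulKVg g'E.
  have [c Zc cE] := free_proj_fiber ((k^-1 * g) A13).
  have [d Zd dE] := free_proj_fiber ((k^-1 * g) A23).
  have [l Kl [lz la lb]] := central_mul Zc Zd.
  have e : k^-1 * g = l.
    apply: P3_aut_ext.
    - by rewrite autME gz lz; exact: aut_inv_eq.
    - by rewrite cE proj_id free_proj_A13 free_emb_gen la.
    - by rewrite dE proj_id free_proj_A23 free_emb_gen lb.
  by rewrite -(mulKVg k g) e; exact: KM.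
case: (aut_z f) => [/fix_z//|fz].
rewrite -(mulgK psi f); apply: KM (KV Kpsi); apply: fix_z.
by case: psiE => psiz _ _; rewrite autME psiz autV fz invgK.
Qed.

End Generation.

End DirectProduct.

Local Open Scope classical_set_scope.
Local Open Scope group_scope.

Lemma subgroup_generated_subgroup (G : groupType) (S : set G) :
  is_subgroup (subgroup_generated S).
Proof.
split.
- by move=> H [[H1 _ _] _].
- by move=> x y Sx Sy H HS; case: (HS) => [[_ HM _] _]; apply: HM; [apply: Sx | apply: Sy].
- by move=> x Sx H HS; case: (HS) => [[_ _ HV] _]; exact: HV (Sx H HS).
Qed.

Theorem proposition4p7 :
  exists rho sigma nu psi phi13 phi23 : Aut_of P3,
    [/\ defined_by (A23 * A12 * A23^-1) A23 A13 rho,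
        defined_by (A12 * A13 ^+ 2) A13^-1 A23 sigma &
        defined_by (A23^-1 * A12) (A13 * A23) A23 nu] /\
    [/\ defined_by (A12 * z ^- 2) A13 A23 psi,
        defined_by (A12 * z) (A13 * z^-1) A23 phi13 &
        defined_by (A12 * z) A13 (A23 * z^-1) phi23] /\
    subgroup_generated [set rho; sigma; nu; psi; phi13; phi23] = setT.
Proof.
have [rho rhoE] := P3_aut_rho; have [sigma sigmaE] := P3_aut_sigma.
have [nu nuE] := P3_aut_nu; have [psi psiE] := P3_aut_psi.
have [phi13 phi13E] := P3_aut_phi13; have [phi23 phi23E] := P3_aut_phi23.
exists rho, sigma, nu, psi, phi13, phi23.
have zC p : p * z = z * p by rewrite z_central.
have zVC p : p * z^-1 = z^-1 * p.
  by apply: commuteV; exact: zC.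
split; last split.
- case: rhoE sigmaE nuE => [rz ? ?] [? ? ?] [nz ? ?].
  split; apply: defined_byI => //.
  + by apply: (@mulIg _ A23); rewrite rz mulgVK -zC /z !mulgA.
  + by rewrite expg2 !mulgA mulgK.
  + by apply: (@mulgI _ A23); rewrite nz zC /z -!mulgA mulVKg.
- case: psiE phi13E phi23E => [pz ? ?] [? ? ?] [qz ? ?].
  split; apply: defined_byI => //.
  + have zVVC : A12 * z ^- 2 = z ^- 2 * A12.
      by apply: commuteV; apply: commuteX; exact: zC.
    have -> : A12 * z ^- 2 * A13 * A23 = z ^- 2 * z by rewrite zVVC /z !mulgA.
    by rewrite pz expg2 [(z * z)^-1]invMg mulgVK.
  + by rewrite zVC mulgA mulgK.
  + by rewrite (zC A12) mulgA -(mulgA z A12) -(mulgA z) -/z mulgK.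
apply/seteqP; split=> // f _.
apply: (generation (subgroup_generated_subgroup _) _ _ _ _ _ _
  rhoE sigmaE nuE psiE phi13E phi23E);
  apply: sub_gen_smallest; rewrite /=; tauto.
Qed.
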